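(* Let $E$ be a finite set, $S=\mathbb{C}[x_e:e\in E]$, and let $I\subset S$ be a standard-homogeneous ideal not containing the irrelevant ideal. Let $w\in\mathbb{R}^E$ and $\Theta^*=\operatorname{subd}_{-w}\mathcal A(I)$. For a cell $\Delta$ of $\Theta^*$, let $I^\Delta=I\cap\mathbb{C}[\Delta]$ and $R^\Delta=\mathbb{C}[\Delta]/I^\Delta$. For cells $\Delta\subset\Gamma$, the projection $\rho^\Gamma_\Delta:\mathbb{C}[\Gamma]\to\mathbb{C}[\Delta]$ (fixing $x_e$ with $a_e\in\Delta$ and killing the other variables) maps $I^\Gamma$ onto $I^\Delta$. Hence it induces a surjection $\pi^\Gamma_\Delta:R^\Gamma\to R^\Delta$, and we obtain a diagram $\mathcal R^*$ of shape $\mathbf J(\Theta^* )^{\mathrm{op}}$ of commutative unital $\mathbb{C}$-algebras. Let $\widetilde I^\Delta$ be the ideal of $S$ generated by $I^\Delta$ and all $x_e$ with $a_e\notin\Delta$. Let $I^w=\bigcap_{\Delta\in\Theta^*}\widetilde I^\Delta$ and $R^w=S/I^w$, and let $c^\Delta:R^w\to R^\Delta=S/\widetilde I^\Delta$ be the natural surjection. Then $(R^w,\{c^\Delta\})$ is a limit of $\mathcal R^*$. In particular, $R^w\cong\varprojlim_{\mathbf J(\Theta^* )^{\mathrm{op}}}R^\Delta$.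
   Context: For $w\in\mathbb{R}^E$, $\operatorname{in}_w p$ is the sum of the terms of $p$ of minimal $w$-weight, and $\operatorname{in}_w I$ is the ideal they generate. $\mathcal L(I)=\{w:\operatorname{in}_wI=I\}$. $\mathcal A(I)=(a_e)_{e\in E}\subset\mathcal L(I)^*$, where $a_e$ is the restriction of the $e$-th coordinate functional to $\mathcal L(I)$. For a point configuration $A=(a_e)$ in $V$ and $u\in\mathbb{R}^E$, $\operatorname{subd}_uA$ consists of the cells $(a_e)_{e\in E_f}$, for $f\in V^*$, where $E_f$ is the set of $e$ minimizing $f(a_e)+u_e$. We write $a_e\in\Delta$ if $e$ is a label of $\Delta$. $\mathbf J(\Theta^* )$ is the poset category of cells ordered by inclusion. $\mathbb{C}[\Delta]=\mathbb{C}[x_e:a_e\in\Delta]$. *)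

(* Defs.v *)
From HB Require Import structures.
From mathcomp Require Import all_boot all_order all_algebra.
From mathcomp Require Import finmap.
From mathcomp Require Import boolp classical_sets reals.
From mathcomp Require Import complex.
From mathcomp.multinomials Require Import monalg.

Set Implicit Arguments.
Unset Strict Implicit.
Unset Printing Implicit Defensive.

Import Order.TTheory GRing.Theory Num.Theory.
Local Open Scope ring_scope.

(* Ideals of a commutative ring, the unit ideal included; the type [idealr] of
   [ring_quotient] only has the proper ones. *)
Definition ideal_closed (A : comPzRingType) (J : {pred A}) :=
  zmod_closed J /\ forall a, {in J, forall x, a * x \in J}.

Record ideal (A : comPzRingType) := Ideal {
  ideal_pred :> {pred A};
  idealP : ideal_closed ideal_pred
}.

HB.instance Definition _ (A : comPzRingType) (J : ideal A) :=
  GRing.isZmodClosed.Build A (ideal_pred J) (idealP J).1.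

Lemma idealM (A : comPzRingType) (J : ideal A) a x : x \in J -> a * x \in J.
Proof. exact: (idealP J).2. Qed.

(* The ideal generated by X: the intersection of the ideals containing X. *)
Section GeneratedIdeal.
Variables (A : comPzRingType) (X : set A).

Fact gen_ideal_closed :
  ideal_closed
    [pred x | `[< forall J : ideal A, (forall y, X y -> y \in J) -> x \in J >]].
Proof.
split; first split=> [|x y].
- by apply/asboolP => J _; exact: rpred0.
- move=> /asboolP xJ /asboolP yJ; apply/asboolP => J XJ.
  by rewrite rpredB ?xJ ?yJ.
- by move=> a x /asboolP xJ; apply/asboolP => J XJ; apply: idealM; exact: xJ.
Qed.

Definition gen_ideal : ideal A := Ideal gen_ideal_closed.

Lemma gen_idealP x :
  reflect (forall J : ideal A, (forall y, X y -> y \in J) -> x \in J)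
          (x \in gen_ideal).
Proof. exact: asboolP. Qed.
End GeneratedIdeal.

Section IdealIntersection.
Variables (A : comPzRingType) (T : Type) (J : T -> ideal A).

Fact inter_ideal_closed : ideal_closed [pred x | `[< forall t, x \in J t >]].
Proof.
split; first split=> [|x y].
- by apply/asboolP => t; exact: rpred0.
- by move=> /asboolP xJ /asboolP yJ; apply/asboolP => t; rewrite rpredB ?xJ ?yJ.
- by move=> a x /asboolP xJ; apply/asboolP => t; apply: idealM; exact: xJ.
Qed.

Definition inter_ideal : ideal A := Ideal inter_ideal_closed.
End IdealIntersection.

Section IdealPreimage.
Variables (A B : comPzRingType) (f : {rmorphism A -> B}) (J : ideal B).

Fact preim_ideal_closed : ideal_closed [pred x | f x \in J].
Proof.
split; first split=> [|x y]; rewrite ?inE ?rmorph0 ?rpred0 //.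
  by move=> xJ yJ; rewrite rmorphB rpredB.
by move=> a x; rewrite !inE rmorphM; exact: idealM.
Qed.

Definition preim_ideal : ideal A := Ideal preim_ideal_closed.
End IdealPreimage.

(* A / J, built on the additive quotient of [ring_quotient]; it may be the zero
   ring. *)
Section QuotientRing.
Variables (A : comPzRingType) (J : ideal A).

Definition quot_ring : Type := Quotient.quot J.
HB.instance Definition _ := GRing.Zmodule.on quot_ring.

Definition quot_pi (x : A) : quot_ring := \pi_(Quotient.quot J)%qT x.

Lemma quot_piE x y : (quot_pi x = quot_pi y) <-> (x - y \in J).
Proof. by rewrite Quotient.idealrBE; split=> /eqP. Qed.

Lemma quot_piB : {morph quot_pi : x y / x - y}.
Proof. exact: raddfB. Qed.

Lemma quot_pi_surj (q : quot_ring) : exists x, quot_pi x = q.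
Proof. by exists (repr (q : Quotient.quot J)); rewrite /quot_pi reprK. Qed.

Let rep (q : quot_ring) : A := repr (q : Quotient.quot J).
Let repK : cancel rep quot_pi.
Proof. by move=> q; rewrite /quot_pi /rep reprK. Qed.

Definition quot_one : quot_ring := quot_pi 1.
Definition quot_mul (p q : quot_ring) : quot_ring := quot_pi (rep p * rep q).

Lemma quot_pi_mul x y : quot_mul (quot_pi x) (quot_pi y) = quot_pi (x * y).
Proof.
apply/quot_piE.
have /quot_piE rx := repK (quot_pi x); have /quot_piE ry := repK (quot_pi y).
set x' := rep _ in rx *; set y' := rep _ in ry *.
have -> : x' * y' - x * y = y' * (x' - x) + x * (y' - y).
  by rewrite !mulrBr addrA [y' * x']mulrC [y' * x]mulrC subrK.
by rewrite rpredD ?idealM.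
Qed.

Fact quot_mulA : associative quot_mul.
Proof.
move=> p q r; rewrite -(repK p) -(repK q) -(repK r).
by rewrite !quot_pi_mul mulrA.
Qed.
Fact quot_mulC : commutative quot_mul.
Proof. by move=> p q; rewrite /quot_mul mulrC. Qed.
Fact quot_mul1 : left_id quot_one quot_mul.
Proof. by move=> p; rewrite -(repK p) quot_pi_mul mul1r. Qed.
Fact quot_mulDl : left_distributive quot_mul +%R.
Proof.
have piD x y : quot_pi x + quot_pi y = quot_pi (x + y) by exact/esym/raddfD.
move=> p q r; rewrite -(repK p) -(repK q) -(repK r).
by rewrite piD !quot_pi_mul piD mulrDl.
Qed.
HB.instance Definition _ := GRing.Zmodule_isComPzRing.Build quot_ring
  quot_mulA quot_mulC quot_mul1 quot_mulDl.

HB.instance Definition _ :=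
  GRing.isZmodMorphism.Build A quot_ring quot_pi quot_piB.
Fact quot_pi_monoid : monoid_morphism quot_pi.
Proof. by split=> // x y; rewrite -quot_pi_mul. Qed.
HB.instance Definition _ :=
  GRing.isMonoidMorphism.Build A quot_ring quot_pi quot_pi_monoid.
End QuotientRing.

(* Commutative unital K-algebras, as commutative rings under K; unlike
   [comAlgType K] this includes the zero algebra. *)
Record calg (K : comPzRingType) := CAlg {
  calg_ring :> comPzRingType;
  calg_unit : {rmorphism K -> calg_ring}
}.

Record calg_hom (K : comPzRingType) (A B : calg K) := CAlgHom {
  calg_fun :> {rmorphism A -> B};
  calg_homP : forall k, calg_fun (calg_unit A k) = calg_unit B k
}.

Definition surjective (T U : Type) (f : T -> U) := forall y, exists x, f x = y.

Definition quot_alg (K : comPzRingType) (A : comAlgType K) (J : ideal A) :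
    calg K :=
  CAlg (@quot_pi A J \o GRing.in_alg A : {rmorphism K -> quot_ring J}).

(* Diagrams of shape J^op, for a type J preordered by le, with objects obj. *)
Record diagram (K : comPzRingType) (J : Type) (le : rel J) (obj : J -> calg K) :=
  Diagram {
    diag_map : forall i j, le i j -> calg_hom (obj j) (obj i);
    diag_id : forall i (h : le i i) x, diag_map h x = x;
    diag_comp : forall i j k (hij : le i j) (hjk : le j k) (hik : le i k) x,
      diag_map hik x = diag_map hij (diag_map hjk x)
  }.

Section Limits.
Variables (K : comPzRingType) (J : Type) (le : rel J) (obj : J -> calg K).
Variable D : diagram le obj.

Definition is_cone (A : calg K) (c : forall j, calg_hom A (obj j)) :=
  forall i j (h : le i j) x, diag_map D h (c j x) = c i x.

Definition is_limit (A : calg K) (c : forall j, calg_hom A (obj j)) :=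
  is_cone c /\
  forall (B : calg K) (b : forall j, calg_hom B (obj j)), is_cone b ->
    exists2 h : calg_hom B A, (forall j x, c j (h x) = b j x) &
      forall h' : calg_hom B A, (forall j x, c j (h' x) = b j x) -> h' =1 h.
End Limits.

Section ProductRing.
Variables (J : Type) (T : J -> comPzRingType).

Definition prod_ring : Type := forall j, T j.
HB.instance Definition _ := Choice.on prod_ring.

Let add (f g : prod_ring) : prod_ring := fun j => f j + g j.
Let opp (f : prod_ring) : prod_ring := fun j => - f j.
Let zero : prod_ring := fun j => 0.
Let mul (f g : prod_ring) : prod_ring := fun j => f j * g j.
Let one : prod_ring := fun j => 1.

Let addA : associative add.
Proof. by move=> f g h; apply: functional_extensionality_dep => j; exact: addrA. Qed.
Let addC : commutative add.
Proof. by move=> f g; apply: functional_extensionality_dep => j; exact: addrC. Qed.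
Let add0 : left_id zero add.
Proof. by move=> f; apply: functional_extensionality_dep => j; exact: add0r. Qed.
Let addN : left_inverse zero opp add.
Proof. by move=> f; apply: functional_extensionality_dep => j; exact: addNr. Qed.
HB.instance Definition _ := GRing.isZmodule.Build prod_ring addA addC add0 addN.

Let mulA : associative mul.
Proof. by move=> f g h; apply: functional_extensionality_dep => j; exact: mulrA. Qed.
Let mulC : commutative mul.
Proof. by move=> f g; apply: functional_extensionality_dep => j; exact: mulrC. Qed.
Let mul1 : left_id one mul.
Proof. by move=> f; apply: functional_extensionality_dep => j; exact: mul1r. Qed.
Let mulDl : left_distributive mul +%R.
Proof. by move=> f g h; apply: functional_extensionality_dep => j; exact: mulrDl. Qed.
HB.instance Definition _ :=
  GRing.Zmodule_isComPzRing.Build prod_ring mulA mulC mul1 mulDl.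
End ProductRing.

(* The standard limit of a diagram of algebras: the compatible families in the
   product. *)
Section LimitAlgebra.
Variables (K : comPzRingType) (J : Type) (le : rel J) (obj : J -> calg K).
Variable D : diagram le obj.

Definition compatible : prod_ring (fun j => obj j : comPzRingType) -> bool :=
  fun f => `[< forall i j (h : le i j), diag_map D h (f j) = f i >].

Fact compatible_subring_closed : subring_closed compatible.
Proof.
split=> [|f g /asboolP fP /asboolP gP|f g /asboolP fP /asboolP gP];
  apply/asboolP => i j h.
- exact: rmorph1.
- by rewrite -[LHS]/(diag_map D h (f j - g j)) rmorphB fP gP.
- by rewrite -[LHS]/(diag_map D h (f j * g j)) rmorphM fP gP.
Qed.
HB.instance Definition _ :=
  GRing.isSubringClosed.Build _ compatible compatible_subring_closed.

Record lim_ring := LimRing { lim_val :> prod_ring _; _ : lim_val \in compatible }.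
HB.instance Definition _ := [isSub for lim_val].
HB.instance Definition _ := [Choice of lim_ring by <:].
HB.instance Definition _ := 
  GRing.SubChoice_isSubComPzRing.Build _ _ lim_ring (subringClosedP _).

Fact lim_unit_subproof k : (fun j => calg_unit (obj j) k) \in compatible.
Proof. by apply/asboolP => i j h; rewrite calg_homP. Qed.

Definition lim_unit (k : K) : lim_ring := LimRing (lim_unit_subproof k).

Fact lim_unit_zmod : zmod_morphism lim_unit.
Proof.
move=> k l; apply: val_inj; apply: functional_extensionality_dep => j.
exact: rmorphB.
Qed.
Fact lim_unit_monoid : monoid_morphism lim_unit.
Proof.
split=> [|k l]; apply: val_inj; apply: functional_extensionality_dep => j.
  exact: rmorph1.
exact: rmorphM.
Qed.
HB.instance Definition _ :=
  GRing.isZmodMorphism.Build K lim_ring lim_unit lim_unit_zmod.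
HB.instance Definition _ :=
  GRing.isMonoidMorphism.Build K lim_ring lim_unit lim_unit_monoid.

Definition lim_alg : calg K := CAlg lim_unit.
End LimitAlgebra.

(* K[x_e : e in E] *)
Notation polyring K E := {malg K[{cmonom E}]}.

Section Polynomials.
Variables (K : comNzRingType) (E : finType).
Implicit Types (p q : polyring K E) (m : {cmonom E}) (D : {set E}).

Definition pvar (e : E) : polyring K E := << ucm e >>.

Definition homogeneous p :=
  exists d : nat, forall m, m \in msupp p -> mdeg m = d.

Definition homogeneous_ideal (I : ideal (polyring K E)) :=
  exists X : set (polyring K E),
    (forall p, X p -> homogeneous p) /\ I =i gen_ideal X.

Definition irrelevant_ideal : ideal (polyring K E) :=
  gen_ideal [set p | exists e, p = pvar e]%classic.

Definition monomial_in D m := [forall e, (m e != 0%N) ==> (e \in D)].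

Definition in_vars D : polyring K E -> bool :=
  fun p => all (monomial_in D) (msupp p).

Lemma in_varsP D p :
  reflect (forall m, m \in msupp p -> monomial_in D m) (p \in in_vars D).
Proof. exact: allP. Qed.

Lemma in_varsU D c m : monomial_in D m -> << c *g m >> \in in_vars D.
Proof.
by move=> mD; apply/in_varsP => m' /(fsubsetP msuppU_le); rewrite inE => /eqP->.
Qed.

Lemma monomial_in1 D : monomial_in D mone.
Proof. by apply/forallP => e; rewrite cm1 eqxx. Qed.

Lemma monomial_inM D m1 m2 :
  monomial_in D m1 -> monomial_in D m2 -> monomial_in D (mmul m1 m2).
Proof.
move=> /forallP m1D /forallP m2D; apply/forallP => e; apply/implyP.
rewrite cmM addn_eq0 negb_and => /orP[].
  exact/implyP/m1D.
exact/implyP/m2D.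
Qed.

Fact in_vars_subalg_closed D : subalg_closed (in_vars D).
Proof.
split=> [|a p q /in_varsP pD /in_varsP qD|p q /in_varsP pD /in_varsP qD].
- exact/in_varsU/monomial_in1.
- apply/in_varsP => m /(fsubsetP (msuppD_le _ _)); rewrite in_fsetU => /orP[|/qD//].
  by move/(fsubsetP (msuppZ_le _ _))/pD.
- apply/in_varsP => m /msuppM_le[m1 [m2 [/pD m1D /qD m2D ->]]].
  exact: monomial_inM.
Qed.
HB.instance Definition _ D := GRing.isSubalgClosed.Build K (polyring K E)
  (in_vars D) (in_vars_subalg_closed D).

(* K[x_e : e in D], as a subalgebra of K[x_e : e in E] *)
Record subpolyring D := SubPoly {
  subpoly_val :> polyring K E;
  _ : subpoly_val \in in_vars D
}.
HB.instance Definition _ D := [isSub for @subpoly_val D].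
HB.instance Definition _ D := [Choice of subpolyring D by <:].
HB.instance Definition _ D := [SubChoice_isSubComNzRing of subpolyring D by <:].
HB.instance Definition _ D :=
  [SubZmodule_isSubLmodule of subpolyring D by <:].
HB.instance Definition _ D :=
  [SubNzRing_SubLmodule_isSubLalgebra of subpolyring D by <:].
HB.instance Definition _ D := [SubLalgebra_isSubAlgebra of subpolyring D by <:].

Definition monomial_eval (g : E -> polyring K E) m : polyring K E :=
  \prod_e g e ^+ m e.

Fact monomial_eval_mmorphism g : mmorphism (monomial_eval g).
Proof.
split=> [m1 m2|]; last by rewrite /monomial_eval big1 // => e _; rewrite cm1.
by rewrite /monomial_eval -big_split; apply: eq_bigr => e _; rewrite cmM exprD.
Qed.
HB.instance Definition _ g :=
  isMultiplicative.Build {cmonom E} (polyring K E) (monomial_eval g)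
    (monomial_eval_mmorphism g).

(* The algebra map fixing x_e for e in D and sending the other variables to 0 *)
Definition kill_outside D : {rmorphism polyring K E -> polyring K E} :=
  mmap (@mkmalgU {cmonom E} K mone)
    (monomial_eval (fun e => if e \in D then pvar e else 0)).

Lemma kill_outside_pvar D e :
  kill_outside D (pvar e) = if e \in D then pvar e else 0.
Proof.
have delta (A : comNzRingType) (g : E -> A) : \prod_i g i ^+ (e == i) = g e.
  rewrite (bigD1 e) //= eqxx expr1 big1 ?mulr1 // => i.
  by rewrite eq_sym => /negPf->.
apply: etrans (mmapU _ _) _; apply: etrans (mul1r _) _.
apply: etrans (delta _ (fun i => if i \in D then pvar i else 0)).
by apply: eq_bigr => i _; congr (_ ^+ _); exact: cmU.
Qed.

Lemma kill_outside_in D p : kill_outside D p \in in_vars D.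
Proof.
apply: rpred_sum => m _; apply: rpredM; first exact/in_varsU/monomial_in1.
apply: rpred_prod => e _; apply: rpredX; case: ifP => [eD|_]; last exact: rpred0.
apply: in_varsU; apply/forallP => e'; rewrite cmU.
by rewrite eqb0 negbK; apply/implyP => /eqP <-.
Qed.

(* rho^G_D, for D \subset G *)
Definition proj (D G : {set E}) (p : subpolyring G) : subpolyring D :=
  SubPoly (kill_outside_in D p).

Definition restr_ideal (I : ideal (polyring K E)) D : ideal (subpolyring D) :=
  preim_ideal (val : {rmorphism subpolyring D -> polyring K E}) I.

Definition ext_ideal (I : ideal (polyring K E)) D : ideal (polyring K E) :=
  gen_ideal [set p | (p \in I) && (p \in in_vars D)
                     \/ exists2 e, e \notin D & p = pvar e]%classic.
End Polynomials.

Section InitialIdeals.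
Variables (R : realType) (K : comNzRingType) (E : finType).
Implicit Types (p q : polyring K E) (m : {cmonom E}) (w : {ffun E -> R^o}).
Implicit Types (P : pred {cmonom E}) (I : ideal (polyring K E)).

Definition weight w m : R := \sum_e w e * (m e)%:R.

(* The sum of the terms of p with monomial in P *)
Definition terms P p : polyring K E :=
  [malg m in msupp p => if P m then p@_m else 0].

Definition init_form w p :=
  terms (fun m => all (fun m' => weight w m <= weight w m') (msupp p)) p.

Definition init_ideal w I : ideal (polyring K E) :=
  gen_ideal [set init_form w p | p in [set p | p \in I]]%classic.

Lemma coeff_terms P p m : (terms P p)@_m = if P m then p@_m else 0.
Proof.
rewrite mcoeffE; case: (boolP (m \in msupp p)) => // /mcoeff_outdom ->.
by rewrite if_same.
Qed.
Local Opaque terms.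

Lemma terms_sub P p m : m \in msupp (terms P p) -> P m /\ m \in msupp p.
Proof.
by rewrite -!mcoeff_neq0 coeff_terms; case: ifP => // _; rewrite eqxx.
Qed.

Definition graded w I := forall p c, p \in I -> terms (fun m => weight w m == c) p \in I.

Lemma termsD P p q : terms P (p + q) = terms P p + terms P q.
Proof.
apply/malgP => m; rewrite [RHS](mcoeffD m (terms P p) (terms P q)).
rewrite [LHS]coeff_terms (coeff_terms P p) (coeff_terms P q) (mcoeffD m p q).
by case: ifP; rewrite ?addr0.
Qed.

Lemma terms0 P : terms P 0 = 0.
Proof. by apply/malgP => m; rewrite coeff_terms mcoeff0 if_same. Qed.

Lemma terms_terms P P' p : terms P (terms P' p) = terms (predI P P') p.
Proof.
by apply/malgP => m; rewrite !coeff_terms /=; case: (P m); case: (P' m).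
Qed.

Let ex_min (f : {cmonom E} -> R) s : s != [::] ->
  exists2 m, m \in s & all (fun m' => f m <= f m') s.
Proof.
elim: s => // m [|m' s] IHs _; first by exists m; rewrite ?inE //= lexx.
have [//|k ks kmin] := IHs; have [mk|/ltW km] := leP (f m) (f k).
  exists m; first exact: mem_head.
  by rewrite /= lexx; apply: sub_all kmin => l; exact: le_trans.
by exists k; [rewrite inE ks orbT | apply/andP].
Qed.

Lemma init_formE w p : p != 0 ->
  exists2 c, init_form w p = terms (fun m => weight w m == c) p &
             exists2 m, m \in msupp p & weight w m = c.
Proof.
move=> p0; have /fset0Pn[m0 m0p] : msupp p != fset0 by rewrite msupp_eq0.
have [|m mp /allP mmin] := @ex_min (weight w) (msupp p).
  by apply/eqP => e; have : m0 \in enum_fset (msupp p) by []; rewrite e.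
exists (weight w m); last by exists m.
apply/malgP => k; rewrite !coeff_terms.
case: (boolP (k \in msupp p)) => [kp|/mcoeff_outdom->]; last by rewrite !if_same.
congr (if _ then _ else _); apply/idP/eqP => [/allP/(_ m mp) km|-> //].
  by apply/le_anti; rewrite km mmin.
by apply/allP.
Qed.

Lemma init_form_ind w (Q : polyring K E -> Prop) : Q 0 ->
  (forall p, p != 0 -> Q (p - init_form w p) -> Q p) -> forall p, Q p.
Proof.
move=> Q0 QS p; move: {2}#|` msupp p|.+1 (ltnSn #|` msupp p|) => n.
elim: n p => // n IHn p; rewrite ltnS => pn.
have [->//|p0] := eqVneq p 0; apply: QS => //; apply: IHn.
have [c -> [m mp mc]] := init_formE w p0.
apply: leq_trans pn; apply: fproper_ltn_card; rewrite fproperE; apply/andP; split.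
  apply/fsubsetP => k.
  rewrite -!mcoeff_neq0 (mcoeffB k p) coeff_terms; apply: contra => /eqP->.
  by rewrite if_same subr0.
by apply/fsubsetPn; exists m => //; rewrite -mcoeff_eq0 (mcoeffB m p) coeff_terms mc eqxx subrr.
Qed.

Lemma init_idealP w I : init_ideal w I =i I <-> graded w I.
Proof.
split=> [eI p c|gI p].
  elim/(@init_form_ind w): p => [_|p p0 IHp pI]; first by rewrite terms0 rpred0.
  have inI : init_form w p \in I.
    by rewrite -eI; apply/gen_idealP => J; apply; exists p.
  rewrite -[p](subrK (init_form w p)) termsD rpredD ?IHp ?rpredB //.
  have [d ed _] := init_formE w p0; rewrite ed terms_terms.
  have [->|cd] := eqVneq c d.
    rewrite (_ : terms _ p = init_form w p) // ed; apply/malgP => m.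
    by rewrite !coeff_terms /= andbb.
  rewrite (_ : terms _ p = 0) ?rpred0 //; apply/malgP => m.
  rewrite !coeff_terms /= mcoeff0; case: ifP => // /andP[/eqP-> /eqP e].
  by rewrite e eqxx in cd.
have inI q : q \in I -> init_form w q \in I.
  have [->|q0] := eqVneq q 0; last by have [c -> _] := init_formE w q0; exact: gI.
  by rewrite /init_form terms0.
apply/idP/idP => [/gen_idealP|]; first by apply=> q [r rI <-]; exact: inI.
elim/(@init_form_ind w): p => [_|p p0 IHp pI]; first exact: rpred0.
rewrite -[p](subrK (init_form w p)) rpredD ?IHp ?rpredB ?inI //.
by apply/gen_idealP => J; apply; exists p.
Qed.

Lemma terms_sum w p :
  p = \sum_(t <- undup [seq weight w m | m <- msupp p])
        terms (fun m => weight w m == t) p.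
Proof.
apply/malgP => m; rewrite raddf_sum /=.
under eq_bigr => t _ do rewrite coeff_terms.
case: (boolP (m \in msupp p)) => mp; last first.
  by rewrite mcoeff_outdom // big1 // => t _; rewrite if_same.
rewrite (bigD1_seq (weight w m)) ?undup_uniq ?mem_undup ?map_f //= eqxx.
by rewrite big1 ?addr0 // => t; rewrite eq_sym => /negPf->.
Qed.

Lemma graded_lin a u v I : graded u I -> graded v I -> graded (a *: u + v) I.
Proof.
move=> gu gv p c pI; rewrite [p](terms_sum u).
have termsS (r : seq R) F P :
    terms P (\sum_(t <- r) F t) = \sum_(t <- r) terms P (F t).
  exact: (big_morph _ (termsD P) (terms0 P)).
rewrite termsS; apply: rpred_sum => t _.
rewrite terms_terms (_ : terms _ p =
  terms (fun m => weight v m == c - a * t) (terms (fun m => weight u m == t) p)).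
  by apply: gv; apply: gu.
apply/malgP => m; rewrite terms_terms !coeff_terms /=.
have -> : weight (a *: u + v) m = a * weight u m + weight v m.
  rewrite /weight mulr_sumr -big_split; apply: eq_bigr => e _ /=.
  by rewrite !ffunE mulrDl mulrA.
have [->|] := eqVneq (weight u m) t; last by rewrite !andbF.
rewrite !andbT; congr (if _ then _ else _).
by rewrite [RHS]eq_sym subr_eq eq_sym addrC.
Qed.

Lemma graded0 I : graded 0 I.
Proof.
move=> p c pI; have w0 m : weight 0 m = 0.
  by rewrite /weight big1 // => e _; rewrite ffunE mul0r.
have [<-|c0] := eqVneq 0 c.
  rewrite (_ : terms _ p = p) //; apply/malgP => m.
  by rewrite coeff_terms w0 eqxx.
rewrite (_ : terms _ p = 0) ?rpred0 //; apply/malgP => m.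
by rewrite coeff_terms w0 (negPf c0) mcoeff0.
Qed.
End InitialIdeals.

Arguments weight {R E} w m.
Arguments init_form {R K E} w p.
Arguments init_ideal {R K E} w I.
Arguments graded {R K E} w I.

(* A subset of a finite-dimensional space closed under linear combinations is a
   subspace. *)
Lemma vspace_of_closed (F : fieldType) (V : vectType F) (P : V -> Prop) :
  P 0 -> (forall a u v, P u -> P v -> P (a *: u + v)) ->
  exists U : {vspace V}, forall v, v \in U <-> P v.
Proof.
move=> P0 Pc.
pose Q n := `[< exists2 U : {vspace V}, \dim U = n & forall v, v \in U -> P v >].
have Q0 : exists n, Q n.
  exists 0%N; apply/asboolP; exists 0%VS; first exact: dimv0.
  by move=> v; rewrite memv0 => /eqP->.
have Qmax n : Q n -> (n <= \dim {:V})%N.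
  by move=> /asboolP[U <- _]; apply/dimvS/subvf.
case: (ex_maxnP Q0 Qmax) => n /asboolP[U Un UP] nmax.
exists U => v; split=> [/UP//|Pv].
suff /eqP -> : U == (U + <[v]>)%VS by apply: subvP (addvSr _ _) _ (memv_line v).
rewrite eqEdim addvSl /= Un; apply: nmax; apply/asboolP; eexists => // u.
by case/memv_addP => x xU [y /vlineP[a ->] ->]; rewrite addrC; apply/Pc/UP.
Qed.

(* L(I); that it is a subspace is part of the construction. *)
Section Lineality.
Variables (R : realType) (K : comNzRingType) (E : finType).
Variable I : ideal (polyring K E).

Fact lineality_subproof : exists U : {vspace {ffun E -> R^o}},
  forall w, w \in U <-> init_ideal w I =i I.
Proof.
have [|a u v|U UP] := @vspace_of_closed _ {ffun E -> R^o} (graded^~ I).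
- exact: graded0.
- exact: graded_lin.
- by exists U => w; rewrite UP; apply: iff_sym; exact: init_idealP.
Qed.

Definition lineality : {vspace {ffun E -> R^o}} := sval (cid lineality_subproof).

Lemma linealityP w : w \in lineality <-> init_ideal w I =i I.
Proof. by rewrite /lineality; case: cid. Qed.

(* A(I), a configuration in the dual of L(I) *)
Definition lin_config (e : E) : 'Hom(subvs_of lineality, R^o) :=
  linfun (fun v : subvs_of lineality => vsval v e : R^o).

Lemma lin_configE e v : lin_config e v = vsval v e.
Proof.
pose f (v : subvs_of lineality) : R^o := vsval v e.
have fL : linear f by move=> a u v'; rewrite /f linearP !ffunE.
pose fl := GRing.isLinear.Build R _ _ _ f fL.
by rewrite (lfunE (HB.pack f fl : {linear subvs_of lineality -> R^o})).
Qed.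
End Lineality.

Arguments lineality {R K E} I.
Arguments lin_config {R K E} I e.

Section Subdivision.
Variables (R : realType) (V : vectType R) (E : finType).
Variables (u : {ffun E -> R^o}) (a : E -> V).

Definition min_labels (f : 'Hom(V, R^o)) : {set E} :=
  [set e | [forall e', f (a e) + u e <= f (a e') + u e']].

(* The cells of subd_u a, given by their sets of labels *)
Record cell := Cell {
  labels :> {set E};
  labelsP : exists f, labels = min_labels f
}.

Definition cell_le : rel cell := fun D G => labels D \subset labels G.
End Subdivision.

Arguments min_labels {R V E} u a f.
Arguments cell {R V E} u a.
Arguments cell_le {R V E u a}.

Section CellAlgebras.
Variables (R : realType) (K : comNzRingType) (E : finType).
Variables (I : ideal (polyring K E)) (w : {ffun E -> R^o}).

(* The poset Theta^* = subd_{-w} A(I) *)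
Definition dual_cell := cell (- w) (lin_config I).
Definition dual_le : rel dual_cell := cell_le.

(* R^D *)
Definition cell_alg (D : dual_cell) : calg K := quot_alg (restr_ideal I D).

Definition ext_alg (D : dual_cell) : calg K := quot_alg (ext_ideal I D).

(* I^w and R^w *)
Definition inter_ext_ideal : ideal (polyring K E) :=
  inter_ideal (fun D : dual_cell => ext_ideal I D).
Definition inter_alg : calg K := quot_alg inter_ext_ideal.
End CellAlgebras.

(* Main.v *)
(* The ideal I is graded by the degree deg m = sum_e m_e a_e, with values in the
   dual of L(I).  On a cell E_f the function f(a_e) - w_e is constant and
   minimal, so a monomial supported on a cell minimizes the height sum_e -m_e w_e
   in its degree, and the minimum is attained exactly by the monomials of that
   degree on the cell.  Hence two monomials of the same degree, each supported on
   some cell, are supported on the same cells.  In particular killing the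
   variables outside a cell keeps or kills a whole graded piece of I^G, and
   therefore preserves I.

   The limit property amounts to gluing a compatible family (q_D).  Cells with
   nonempty intersection meet in a cell, so a monomial m <> 1 supported on a cell
   has a smallest supporting cell D(m); the coefficient of m in the glued
   polynomial is its coefficient in q_{D(m)}.  The cell D(m) depends only on the
   degree of m, so the glued polynomial restricts to q_G modulo I degree by
   degree.  The monomial 1 is supported on all cells, and the constant
   coefficients agree because 1 is not in I and the poset of cells is connected:
   any two functionals f, g are joined by the segment f + t (g - f). *)

Require Import Defs.
From HB Require Import structures.
From mathcomp Require Import all_boot all_order all_algebra finmap.
From mathcomp Require Import ring lra.
From mathcomp Require Import boolp classical_sets reals complex.
From mathcomp.multinomials Require Import monalg.

Set Implicit Arguments.
Unset Strict Implicit.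
Unset Printing Implicit Defensive.

Import Order.TTheory GRing.Theory Num.Theory.
Local Open Scope ring_scope.

(** * Limits and quotients *)

Section AlgebraHoms.
Variables (K : comPzRingType) (A B : calg K).

Lemma calg_hom_of_fun (f : A -> B) :
    zmod_morphism f -> monoid_morphism f ->
    (forall k, f (calg_unit A k) = calg_unit B k) ->
  exists g : calg_hom A B, g =1 f.
Proof.
move=> fB fM fK.
pose fb := GRing.isZmodMorphism.Build A B f fB.
pose fm := GRing.isMonoidMorphism.Build A B f fM.
by exists (@CAlgHom _ A B (HB.pack f fb fm : {rmorphism A -> B}) fK).
Qed.
End AlgebraHoms.

Lemma quot_lift (K : comPzRingType) (A : comAlgType K) (J : ideal A)
    (B : calg K) (f : {rmorphism A -> B}) :
    {in J, forall x, f x = 0} -> (forall k, f k%:A = calg_unit B k) ->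
  exists h : calg_hom (quot_alg J) B, forall x, h (quot_pi J x) = f x.
Proof.
move=> fJ fK; pose h (q : quot_ring J) := f (repr (q : Quotient.quot J)).
have hE x : h (quot_pi J x) = f x.
  have /quot_piE /fJ : quot_pi J (repr (quot_pi J x : Quotient.quot J)) = quot_pi J x.
    by rewrite {1}/quot_pi reprK.
  by rewrite rmorphB => /eqP; rewrite subr_eq0 => /eqP.
have hB : zmod_morphism h.
  move=> p q; case: (quot_pi_surj p) => x <-; case: (quot_pi_surj q) => y <-.
  by rewrite -rmorphB !hE rmorphB.
have hM : monoid_morphism h.
  split=> [|p q]; first by rewrite -(rmorph1 (quot_pi J)) hE rmorph1.
  case: (quot_pi_surj p) => x <-; case: (quot_pi_surj q) => y <-.
  by rewrite -rmorphM !hE rmorphM.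
have hK k : h (calg_unit (quot_alg J) k) = calg_unit B k by rewrite /= hE fK.
case: (@calg_hom_of_fun K (quot_alg J) B h hB hM hK) => g gE.
by exists g => x; rewrite gE hE.
Qed.

Section LimitCriterion.
Variables (K : comPzRingType) (J : Type) (le : rel J) (obj : J -> calg K).
Variables (D : diagram le obj) (A : calg K) (c : forall j, calg_hom A (obj j)).
Hypothesis c_cone : is_cone D c.
Hypothesis c_inj : forall x y, (forall j, c j x = c j y) -> x = y.
Hypothesis c_lift : forall f : forall j, obj j,
  (forall i j (h : le i j), diag_map D h (f j) = f i) ->
  exists x, forall j, c j x = f j.

(** The hypotheses identify [A] with the set of compatible families. Joint injectivity of [c] lets
    the ring identities of the factorization, and its uniqueness, be checked one component at a
    time. *)
Lemma limit_of_lifts : is_limit D c.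
Proof.
split=> // B b b_cone.
have b_lift x : exists y, forall j, c j y = b j x.
  by apply: c_lift => i j h; exact: b_cone.
pose h x := sval (cid (b_lift x)).
have hE j x : c j (h x) = b j x by rewrite /h; case: cid.
have [|||g gE] := @calg_hom_of_fun K B A h.
- by move=> x y; apply: c_inj => j; rewrite rmorphB !hE rmorphB.
- split=> [|x y]; apply: c_inj => j; first by rewrite hE !rmorph1.
  by rewrite rmorphM !hE rmorphM.
- by move=> k; apply: c_inj => j; rewrite hE !calg_homP.
exists g => [j x|g' g'E x]; first by rewrite gE.
by apply: c_inj => j; rewrite g'E gE hE.
Qed.

Lemma lim_alg_iso : exists2 phi : calg_hom A (lim_alg D),
  bijective phi & forall j x, lim_val (phi x) j = c j x.
Proof.
have phi_in x : (fun j => c j x) \in compatible D.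
  by apply/asboolP => i j h; exact: c_cone.
pose phi x : lim_ring D := LimRing (phi_in x).
have phi_eq x (y : lim_ring D) : (forall j, c j x = lim_val y j) -> phi x = y.
  by move=> xy; apply: val_inj; apply: functional_extensionality_dep.
have [|||g gE] := @calg_hom_of_fun K A (lim_alg D) phi.
- by move=> x y; apply: phi_eq => j; rewrite rmorphB.
- split=> [|x y]; apply: phi_eq => j; first by rewrite rmorph1.
  by rewrite rmorphM.
- by move=> k; apply: phi_eq => j; rewrite calg_homP.
have gc j x : lim_val (g x) j = c j x by rewrite gE.
exists g => //.
have lift (y : lim_ring D) : exists x, forall j, c j x = lim_val y j.
  by case: y => y /= /asboolP yc; exact: c_lift.
exists (fun y => sval (cid (lift y))) => [x|y]; case: cid => /= z zE.
  by apply: c_inj => j; rewrite zE gc.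
by rewrite gE; exact: phi_eq.
Qed.
End LimitCriterion.

(** * Lower envelopes of lines *)

Section LowerEnvelope.
Variables (R : realFieldType) (E : finType) (alpha beta : E -> R).

Let line t e := alpha e + t * beta e.
Let argmins t : {set E} := [set e | [forall e', line t e <= line t e']].

(* Moving right from [s] along the lower envelope, the next breakpoint has both
   the current line and a line of smaller slope as labels. *)
Lemma lower_envelope_walk (T : Type) (P : R -> T) :
    (forall s t, argmins s \subset argmins t -> P s = P t) ->
  forall e s t, s <= t -> e \in argmins s -> P s = P t.
Proof.
move=> P_sub.
have P_meet s t e : e \in argmins s -> e \in argmins t -> P s = P t.
  move=> es et; pose r := (s + t) / 2%:R.
  have line_mid x : line r x = (line s x + line t x) / 2%:R.
    by rewrite /line /r; field.
  rewrite !inE in es et; move/forallP: es => es; move/forallP: et => et.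
  have sub u (le_r : forall x, line u x - line u e <= 2%:R * (line r x - line r e)) :
      (forall x, line u e <= line u x) -> argmins r \subset argmins u.
    move=> eu; apply/fintype.subsetP => x; rewrite !inE => /forallP xr.
    apply/forallP => y; apply: le_trans (eu y).
    rewrite -subr_le0; apply: le_trans (le_r x) _.
    by rewrite pmulr_rle0 // subr_le0.
  rewrite -(P_sub r s) -?(P_sub r t) //; apply: sub => // x; rewrite !line_mid.
    by have := es x; lra.
  by have := et x; lra.
(* Induction on the number of lines of smaller slope than that of [e]. *)
move=> e; move: {2}#|[set x | beta x < beta e]|.+1 (ltnSn #|[set x | beta x < beta e]|).
move=> n; elim: n e => // n IHn e; rewrite ltnS => le_n s t st es.
have [et|] := boolP (e \in argmins t); first exact: P_meet et.
rewrite inE negb_forall => /existsP[x0]; rewrite -ltNge => x0t.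
have les x : line s e <= line s x by move: es; rewrite inE => /forallP.
have x0e : beta x0 < beta e.
  rewrite ltNge; apply/negP => ex0; have := les x0; move: x0t; rewrite /line.
  by have := ler_wpM2r (_ : 0 <= t - s) ex0; nra.
(* The parameter at which line [x] crosses line [e]; its minimum over the lines of smaller slope is
   the next breakpoint. *)
pose tau x := (alpha x - alpha e) / (beta e - beta x).
case: (@Order.TotalTheory.arg_minP _ _ _ x0 (fun x => beta x < beta e) tau x0e).
move=> x xe tau_min.
have tauP y u : beta y < beta e -> (line u e <= line u y) = (u <= tau y).
  move=> ye; rewrite /tau ler_pdivlMr ?subr_gt0 // /line.
  by rewrite -subr_ge0 -[in RHS]subr_ge0; congr (0 <= _); ring.
have sx : s <= tau x by rewrite -tauP.
have xt : tau x <= t.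
  apply: le_trans (tau_min x0 x0e) _; rewrite leNgt; apply/negP => /ltW.
  by rewrite -tauP // leNgt x0t.
have etau : e \in argmins (tau x).
  rewrite inE; apply/forallP => y.
  have [ye|ey] := ltP (beta y) (beta e); first by rewrite tauP // tau_min.
  have := les y; rewrite /line; nra.
have xtau : x \in argmins (tau x).
  have xE : line (tau x) x = line (tau x) e.
    by rewrite /line /tau; field; rewrite subr_eq0 gt_eqF.
  by move: etau; rewrite !inE => /forallP eP; apply/forallP => y; rewrite xE.
rewrite (P_meet s (tau x) e) //; apply: (IHn x) => //.
apply: leq_trans le_n; apply: proper_card; apply/properP; split.
  by apply/fintype.subsetP => y; rewrite !inE => /lt_trans; apply.
by exists x; rewrite !inE ?xe // ltxx.
Qed.
End LowerEnvelope.

(** * Polynomials and gradings *)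

Section Monomials.
Variables (K : comNzRingType) (E : finType).
Implicit Types (p q : polyring K E) (m : {cmonom E}) (D G : {set E}).

Lemma ucm_dvd m e : m e != 0%N -> exists m', m = mmul (ucm e) m'.
Proof.
move=> me; exists (divcm m (ucm e)); apply/eqP/cmP => i.
rewrite cmM divcmE cmU; have [<-|] := eqVneq e i; last by rewrite add0n subn0.
by rewrite subnKC // lt0n.
Qed.

Lemma cmonom_eq1 m : (forall e, m e = 0%N) -> m = mone.
Proof. by move=> m0; apply/eqP/cmP => e; rewrite cm1. Qed.

Lemma mdeg_sum m : mdeg m = \sum_e m e.
Proof.
rewrite (@mdegEw _ m [fset e | e in E]%fset); last first.
  by apply/fsubsetP => e _; rewrite in_imfset.
rewrite big_imfset //= big_enum_cond; apply: eq_bigl => e.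
by rewrite andbT.
Qed.

Lemma malgUM (a b : K) m1 m2 :
  << a *g m1 >> * << b *g m2 >> = << a * b *g mmul m1 m2 >> :> polyring K E.
Proof. by rewrite malgM_def fgmulUU. Qed.

Lemma malgUZ (a : K) m : << a *g m >> = a *: << m >> :> polyring K E.
Proof. by rewrite -mul_malgC malgUM mulr1 mul1m. Qed.

Lemma monomial_inUM D e m :
  monomial_in D (mmul (ucm e) m) = (e \in D) && monomial_in D m.
Proof.
apply/forallP/andP => [DP|[eD /forallP mD] i]; last first.
  rewrite cmM cmU; have [<-|_] := eqVneq e i; rewrite ?eD ?implybT //; exact: mD.
split; first by have := DP e; rewrite cmM cmU eqxx.
apply/forallP => i; have := DP i; rewrite cmM cmU; apply: contraTT.
by rewrite !negb_imply addn_eq0 negb_and => /andP[-> ->]; rewrite orbT.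
Qed.

Lemma kill_outsideU D m :
  kill_outside K D << m >> = if monomial_in D m then << m >> else 0.
Proof.
move: {2}(mdeg m) (erefl (mdeg m)) => n; elim: n m => [|n IHn] m.
  move=> /mdeg_eq0I ->; rewrite monomial_in1; exact: rmorph1.
move=> mn; have [e me] : exists e, m e != 0%N.
  apply/existsP; rewrite -negb_forall; apply: contra_eqN mn => /forallP m0.
  by rewrite (@cmonom_eq1 m) ?mdeg1 // => e; exact/eqP.
have [m' mE] := ucm_dvd me; move: mn.
rewrite mE mdegM mdegU add1n => -[m'n].
have -> : << mmul (ucm e) m' >> = pvar K e * << m' >> by rewrite malgUM mulr1.
rewrite [LHS](rmorphM (kill_outside K D) (pvar K e) << m' >>).
rewrite [LHS](f_equal2 *%R (kill_outside_pvar K D e) (IHn _ m'n)) monomial_inUM.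
by case: (e \in D) (monomial_in D m') => -[]; rewrite ?mulr0 ?mul0r.
Qed.

Lemma kill_outsideZ D (a : K) p :
  kill_outside K D (a *: p) = a *: kill_outside K D p.
Proof. rewrite -[RHS]mul_malgC; exact: mmapZ. Qed.

Lemma malg_sum p : p = \sum_(m <- msupp p) p@_m *: << m >>.
Proof. by rewrite {1}[p]monalgE; apply: eq_bigr => m _; rewrite malgUZ. Qed.

Local Opaque kill_outside terms.

Lemma kill_outside_sum D p : kill_outside K D p =
  \sum_(m <- msupp p) p@_m *: (if monomial_in D m then << m >> else 0).
Proof.
rewrite {1}[p]malg_sum rmorph_sum; apply: eq_bigr => m _.
by rewrite -kill_outsideU -kill_outsideZ.
Qed.

(** Turns the evaluation morphism into a selection of terms, which can be composed with the
    selection of a graded piece. *)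
Lemma kill_outsideE D p : kill_outside K D p = terms (monomial_in D) p.
Proof.
apply/malgP => k; rewrite coeff_terms kill_outside_sum raddf_sum /=.
under eq_bigr => m _ do rewrite mcoeffZ.
rewrite (_ : (if _ then _ else _) = (if monomial_in D k then 1 else 0) * p@_k);
  last by case: ifP; rewrite ?mul1r ?mul0r.
rewrite [p in RHS]malg_sum raddf_sum /= mulr_sumr; apply: eq_bigr => m _.
rewrite mcoeffZ mulrCA; congr (_ * _); rewrite mcoeffU1.
have [->|mk] := eqVneq m k; last first.
  by rewrite mulr0; case: ifP; rewrite ?mcoeff0 // mcoeffU1 (negPf mk).
by case: ifP; rewrite ?mcoeff0 ?mul0r // mcoeffU1 eqxx mulr1.
Qed.

Lemma coeff_kill_outside D p m :
  (kill_outside K D p)@_m = if monomial_in D m then p@_m else 0.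
Proof. by rewrite kill_outsideE coeff_terms. Qed.

Lemma terms_id (P : pred {cmonom E}) p :
  (forall m, m \in msupp p -> P m) -> terms P p = p.
Proof.
move=> Pp; apply/malgP => m; rewrite coeff_terms; case: ifP => // Pm.
by rewrite mcoeff_outdom //; apply: contraFN Pm; exact: Pp.
Qed.

Lemma kill_outside_id D p : p \in in_vars D -> kill_outside K D p = p.
Proof. by move=> /in_varsP pD; rewrite kill_outsideE terms_id. Qed.

Lemma terms_eq (P Q : pred {cmonom E}) p q :
    (forall m, (if P m then p@_m else 0) = (if Q m then q@_m else 0)) ->
  terms P p = terms Q q.
Proof. by move=> e; apply/malgP => m; rewrite !coeff_terms. Qed.

Lemma kill_outside_comp D G p : D \subset G ->
  kill_outside K D (kill_outside K G p) = kill_outside K D p.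
Proof.
move=> DG; rewrite [LHS]kill_outsideE [in LHS]kill_outsideE kill_outsideE terms_terms.
apply: terms_eq => m /=.
case: (boolP (monomial_in D m)) => //= /forallP mD.
rewrite ifT //; apply/forallP => e; apply/implyP => me.
by apply: (fintype.subsetP DG); apply: (implyP (mD e)).
Qed.

Lemma ideal_scale (J : ideal (polyring K E)) (a : K) p : p \in J -> a *: p \in J.
Proof. by rewrite -mul_malgC; exact: idealM. Qed.

(** The preimage of [I] under [kill_outside K D] is an ideal containing both kinds of generators.
    Conversely, [p] minus its image is a combination of monomials divisible by a variable outside
    [D]. *)
Lemma mem_ext_ideal (I : ideal (polyring K E)) D p :
  p \in ext_ideal I D <-> kill_outside K D p \in I.
Proof.
split=> [/gen_idealP pJ|pI].
  have : p \in preim_ideal (kill_outside K D) I; last by rewrite inE.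
  apply: pJ => q [/andP[qI qD]|[e eD ->]].
    by rewrite inE kill_outside_id.
  by rewrite inE kill_outside_pvar (negPf eD) rpred0.
rewrite -[p](subrK (kill_outside K D p)) rpredD //; last first.
  by apply/gen_idealP => J; apply; left; rewrite pI kill_outside_in.
rewrite kill_outside_sum {1}[p]malg_sum -sumrB; apply: rpred_sum => m _.
rewrite -scalerBr; apply: ideal_scale; case: ifP => mD.
  by rewrite subrr rpred0.
move/negbT: mD; rewrite negb_forall => /existsP[e]; rewrite negb_imply => /andP[me eD].
have [m' ->] := ucm_dvd me.
rewrite subr0 (_ : << _ >> = << m' >> * pvar K e); last by rewrite mulrC malgUM mulr1.
by apply: idealM; apply/gen_idealP => J; apply; right; exists e.
Qed.

Lemma terms_lin_sum (P : pred {cmonom E}) (T : Type) (s : seq T) (F : T -> polyring K E) :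
  terms P (\sum_(t <- s) F t) = \sum_(t <- s) terms P (F t).
Proof. exact: (big_morph _ (termsD P) (terms0 K P)). Qed.

Lemma termsB (P : pred {cmonom E}) p q : terms P (p - q) = terms P p - terms P q.
Proof. by apply: (addIr (terms P q)); rewrite -termsD !subrK. Qed.

Lemma termsU (P : pred {cmonom E}) (a : K) m :
  terms P << a *g m >> = if P m then << a *g m >> else 0.
Proof.
apply/malgP => k; rewrite coeff_terms (fun_if (mcoeff k)) mcoeff0 mcoeffU.
by have [->|] := eqVneq m k; rewrite ?mulr0n ?if_same.
Qed.

Lemma terms_partition (T : eqType) (d : {cmonom E} -> T) p :
  p = \sum_(t <- undup [seq d m | m <- msupp p]) terms (fun m => d m == t) p.
Proof.
apply/malgP => m; rewrite raddf_sum /=.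
under eq_bigr => t _ do rewrite coeff_terms.
case: (boolP (m \in msupp p)) => mp; last first.
  by rewrite mcoeff_outdom // big1 // => t _; rewrite if_same.
rewrite (bigD1_seq (d m)) ?undup_uniq ?mem_undup ?map_f //= eqxx.
by rewrite big1 ?addr0 // => t; rewrite eq_sym => /negPf->.
Qed.
End Monomials.

(** * Gradings by weight vectors *)

Section Gradings.
Variables (R : realType) (K : comNzRingType) (E : finType).
Implicit Types (p q : polyring K E) (m : {cmonom E}) (w : {ffun E -> R^o}).

Lemma weightM w m1 m2 : weight w (mmul m1 m2) = weight w m1 + weight w m2.
Proof.
rewrite /weight -big_split; apply: eq_bigr => e _ /=.
by rewrite cmM natrD mulrDr.
Qed.

Lemma terms_malgUM w (c : R) (a : K) m p :
  terms (fun k => weight w k == c) (<< a *g m >> * p) =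
  << a *g m >> * terms (fun k => weight w k == c - weight w m) p.
Proof.
rewrite [p]monalgE mulr_sumr !terms_lin_sum mulr_sumr; apply: eq_bigr => k _.
rewrite malgUM !termsU weightM.
rewrite [RHS](fun_if (fun x => << a *g m >> * x)) mulr0 malgUM.
by rewrite [in RHS]eq_sym subr_eq eq_sym addrC.
Qed.

(** The polynomials whose weight components all lie in [gen_ideal X] form an ideal, because
    multiplication by a monomial only shifts weights. This ideal contains [X]. *)
Lemma graded_gen_ideal w (X : set (polyring K E)) :
    (forall p, X p -> exists c, forall m, m \in msupp p -> weight w m = c) ->
  graded w (gen_ideal X).
Proof.
move=> Xw p c pX; pose T c := terms (K := K) (fun k => weight w k == c).
pose J p := `[< forall c, T c p \in gen_ideal X >].
have J_ideal : ideal_closed J.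
  split; first split=> [|q r].
  - by apply/asboolP => d; rewrite /T terms0 rpred0.
  - move=> /asboolP qJ /asboolP rJ; apply/asboolP => d.
    by rewrite /T termsB rpredB ?qJ ?rJ.
  - move=> a q /asboolP qJ; apply/asboolP => d.
    rewrite [a]monalgE mulr_suml /T terms_lin_sum; apply: rpred_sum => m _.
    by rewrite terms_malgUM; apply: idealM; exact: qJ.
have /gen_idealP/(_ (Ideal J_ideal)) : p \in gen_ideal X by [].
suff -> : (p \in Ideal J_ideal) = `[< forall c, T c p \in gen_ideal X >].
  move=> pJ; apply: (asboolP _ (pJ _)) => y Xy; apply/asboolP => d.
  have [e ye] := Xw y Xy; have [ed|ed] := eqVneq e d.
    rewrite /T terms_id; first by apply/gen_idealP => J'; apply.
    by move=> m /ye ->; rewrite ed.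
  rewrite (_ : T d y = 0) ?rpred0 //; apply/malgP => m; rewrite coeff_terms mcoeff0.
  case: (boolP (m \in msupp y)) => [/ye ->|/mcoeff_outdom ->]; last by rewrite if_same.
  by rewrite (negPf ed).
by [].
Qed.

Lemma weight1 m : weight [ffun=> 1 : R^o] m = (mdeg m)%:R.
Proof.
by rewrite mdeg_sum natr_sum; apply: eq_bigr => e _; rewrite ffunE mul1r.
Qed.

(** The weight given by the all-ones vector is the total degree. Standard homogeneity enters the
    proof through this vector. *)
Lemma one_lineality (I : ideal (polyring K E)) :
  homogeneous_ideal I -> [ffun=> 1] \in lineality (R := R) I.
Proof.
case=> X [Xhom IX]; apply/linealityP/init_idealP => p c; rewrite !IX.
apply: graded_gen_ideal => q /Xhom[d qd]; exists d%:R => m /qd <-.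
exact: weight1.
Qed.
End Gradings.

Local Opaque kill_outside terms.

(** * Cells *)

Section MinLabels.
Variables (R : realType) (V : vectType R) (E : finType).
Variables (u : {ffun E -> R^o}) (a : E -> V).
Implicit Types (f g : 'Hom(V, R^o)) (m : {cmonom E}) (D : {set E}).

Let height f e : R := f (a e) + u e.
Let total f m : R := \sum_e (m e)%:R * height f e.

Lemma min_labelsP f e :
  reflect (forall e', height f e <= height f e') (e \in min_labels u a f).
Proof. by rewrite inE; exact: forallP. Qed.

(** The labels occurring in [m] all have the minimal height, so the total of [m] is its degree times
    that height. This bounds the total of [m'] from below, with equality only if every label of [m']
    is minimal. *)
Lemma total_height_le f m m' :
    monomial_in (min_labels u a f) m -> mdeg m = mdeg m' ->
  total f m <= total f m' /\
  (total f m' <= total f m -> monomial_in (min_labels u a f) m').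
Proof.
move=> /forallP mD mm'.
(* The monomial 1 has no label that could supply the minimal height; it is left to the end. *)
have [m0|/existsP[e0 me0]] := boolP [forall e, m e == 0%N]; last first.
  have /min_labelsP e0min : e0 \in min_labels u a f by apply: (implyP (mD e0)).
  have height_m e : (m e)%:R * height f e = (m e)%:R * height f e0.
    have [->|me] := eqVneq (m e) 0%N; first by rewrite !mul0r.
    have /min_labelsP emin : e \in min_labels u a f by apply: (implyP (mD e)).
    by congr (_ * _); apply/le_anti; rewrite emin e0min.
  have -> : total f m = \sum_e (m' e)%:R * height f e0.
    rewrite /total; under eq_bigr => e _ do rewrite height_m.
    by rewrite -!mulr_suml -!natr_sum -!mdeg_sum mm'.
  have le_e e : (m' e)%:R * height f e0 <= (m' e)%:R * height f e.
    by rewrite ler_wpM2l.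
  split; first by apply: ler_sum => e _.
  move=> le_tot; apply/forallP => e; apply/implyP => m'e.
  have /eqP : total f m' - \sum_e (m' e)%:R * height f e0 = 0.
    by apply/eqP; rewrite subr_eq0; apply/eqP/le_anti; rewrite le_tot ler_sum.
  rewrite -sumrB psumr_eq0 => [/allP/(_ e)|i _]; last by rewrite subr_ge0.
  rewrite mem_index_enum => /(_ isT)/implyP/(_ isT).
  rewrite -mulrBr mulf_eq0 pnatr_eq0 (negPf m'e) subr_eq0 /= => /eqP he.
  by apply/min_labelsP => e'; rewrite he.
have m'0 e : m' e = 0%N.
  have : mdeg m' = 0%N.
    by rewrite -mm' mdeg_sum big1 // => i _; apply/eqP/(forallP m0).
  by move/mdeg_eq0I ->; rewrite cm1.
split; last by move=> _; apply/forallP => e; rewrite m'0.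
rewrite /total !big1 // => e _; first by rewrite m'0 mul0r.
by rewrite (eqP (forallP m0 e)) mul0r.
Qed.

(* A monomial supported on a cell minimizes the total height [u] among the
   monomials of its degree, and only monomials on that cell attain the
   minimum. *)
Lemma monomial_in_cell f g m m' :
    mdeg m = mdeg m' ->
    \sum_e (m e)%:R *: a e = \sum_e (m' e)%:R *: a e ->
    monomial_in (min_labels u a f) m -> monomial_in (min_labels u a g) m' ->
  monomial_in (min_labels u a f) m'.
Proof.
move=> mm' am mf m'g.
(* The functional enters the total only through the degree of the monomial. Hence the comparison of
   [m] with [m'] is the same for [f] as for [g], and minimality of [m'] for [g] transfers to [f]. *)
have totalE h k : total h k = h (\sum_e (k e)%:R *: a e) + \sum_e (k e)%:R * u e.
  rewrite linear_sum -big_split; apply: eq_bigr => e _ /=.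
  by rewrite linearZ mulrDr.
have [_] := total_height_le mf mm'; apply.
have [] := total_height_le m'g (esym mm'); rewrite !totalE am => + _.
by rewrite !lerD2l.
Qed.

(** The average of [f] and [g] works: since [e] is minimal for both, a label attains the minimal
    average height exactly when it is minimal for both. *)
Lemma min_labels_meet f g e :
    e \in min_labels u a f -> e \in min_labels u a g ->
  exists h, min_labels u a f :&: min_labels u a g = min_labels u a h.
Proof.
move=> /min_labelsP ef /min_labelsP eg; exists (2%:R^-1 *: (f + g)).
have hE x : height (2%:R^-1 *: (f + g)) x = (height f x + height g x) / 2%:R.
  rewrite /height scale_lfunE add_lfunE.
  by rewrite -[_ *: _]/(_ * _); field.
apply/setP => x; rewrite finset.in_setI.
apply/andP/min_labelsP => [[/min_labelsP xf /min_labelsP xg] y|xh].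
  by rewrite !hE; have := xf y; have := xg y; lra.
split; apply/min_labelsP => y; have := xh e; rewrite !hE;
  have := ef x; have := eg x; have := ef y; have := eg y; lra.
Qed.

(** Along the segment from [f] to [g] each label has a height affine in [t], so
    [lower_envelope_walk] applies with slopes [g (a e) - f (a e)]. *)
Lemma min_labels_connected (T : Type) (P : 'Hom(V, R^o) -> T) :
    (forall f g, min_labels u a f \subset min_labels u a g -> P f = P g) ->
  forall f g, P f = P g.
Proof.
move=> P_sub f g.
pose path t := f + t *: (g - f).
have heightE t e : height (path t) e = height f e + t * (g (a e) - f (a e)).
  rewrite /height /path add_lfunE scale_lfunE add_lfunE opp_lfunE.
  by rewrite -[t *: _]/(t * _); ring.
have path0 : path 0 = f by rewrite /path scale0r addr0.
have path1 : path 1 = g by rewrite /path scale1r addrC subrK.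
have [e ef|f0] := pickP (mem (min_labels u a f)).
  rewrite -path0 -path1.
  have argminsE t : min_labels u a (path t) = [set e | [forall e',
      height f e + t * (g (a e) - f (a e)) <= height f e' + t * (g (a e') - f (a e'))]].
    apply/setP => x; rewrite !inE; apply: eq_forallb => y.
    by rewrite -/(height (path t) x) -/(height (path t) y) !heightE.
  apply: (@lower_envelope_walk _ _ (height f) (fun e => g (a e) - f (a e)) T (P \o path)
    _ e 0 1) => //.
    by move=> s t st; apply: P_sub; rewrite !argminsE.
  by rewrite -argminsE path0.
(* Here the label set of [f] is empty, hence included in that of [g]. *)
by apply: P_sub; apply/fintype.subsetP => e; rewrite [e \in _]f0.
Qed.
End MinLabels.

(** * The grading by the dual of the lineality space *)

Section Lineality.
Variables (R : realType) (K : comNzRingType) (E : finType).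
Variable I : ideal (polyring K E).
Hypothesis homI : homogeneous_ideal I.
Implicit Types (p q : polyring K E) (m : {cmonom E}) (D : {set E}).

(* The degree of a monomial in the finest grading of [I], with values in the
   dual of the lineality space. *)
Definition lin_deg m : 'Hom(subvs_of (lineality (R := R) I), R^o) :=
  \sum_e (m e)%:R *: lin_config I e.

Lemma lin_degE m v : lin_deg m v = weight (vsval v) m.
Proof.
rewrite /lin_deg sum_lfunE; apply: eq_bigr => e _.
by rewrite scale_lfunE lin_configE mulrC.
Qed.

(** Evaluation at the all-ones vector recovers the total degree. *)
Lemma lin_deg_mdeg m m' : lin_deg m = lin_deg m' -> mdeg m = mdeg m'.
Proof.
move=> mm'; have := lin_degE m (Subvs (one_lineality R homI)).
rewrite mm' lin_degE /= !weight1 => /eqP.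
by rewrite eqr_nat eq_sym => /eqP.
Qed.

(** A functional is determined by its values on a basis, so the piece of degree [b] is cut out by
    finitely many successive weight selections, each of which preserves [I]. *)
Lemma terms_lin_deg b p : p \in I -> terms (fun m => lin_deg m == b) p \in I.
Proof.
move=> pI; set vs := vbasis (fullv : {vspace subvs_of (lineality (R := R) I)}).
have all_in (s : seq (subvs_of (lineality (R := R) I))) :
    terms (fun m => all (fun v => weight (vsval v) m == b v) s) p \in I.
  elim: s => [|v s IHs]; first by rewrite terms_id.
  have := (init_idealP _ _).1 ((linealityP _ _).1 (subvsP v)) _ (b v) IHs.
  by rewrite terms_terms.
rewrite (_ : terms _ p = terms (fun m => all (fun v => weight (vsval v) m == b v) vs) p) //.
apply: terms_eq => m; congr (if _ then _ else _); apply/eqP/allP => [<- v _|mb].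
  by rewrite lin_degE.
apply/lfunP => v; rewrite (coord_vbasis (memvf v)) !linear_sum.
apply: eq_bigr => i _; rewrite !linearZ /= lin_degE; congr (_ * _).
by apply/eqP/mb/mem_nth; rewrite size_tuple.
Qed.

Lemma ideal_lin_deg q :
  (forall b, terms (fun m => lin_deg m == b) q \in I) -> q \in I.
Proof.
by move=> qI; rewrite [q](terms_partition lin_deg); apply: rpred_sum => b _.
Qed.

Variable w : {ffun E -> R^o}.
Notation cells := (dual_cell I w).

Lemma monomial_in_dual_cell (D G : cells) m m' : lin_deg m = lin_deg m' ->
  monomial_in D m -> monomial_in G m' -> monomial_in D m'.
Proof.
move=> mm'; have [f ->] := labelsP D; have [g ->] := labelsP G.
exact: monomial_in_cell (lin_deg_mdeg mm') mm'.
Qed.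

Lemma kill_outside_ideal (D G : cells) p :
  p \in I -> p \in in_vars G -> kill_outside K D p \in I.
Proof.
move=> pI /in_varsP pG; apply: ideal_lin_deg => b; rewrite kill_outsideE terms_terms.
have [/hasP[m0 m0p /andP[/eqP m0b m0D]]|/hasPn none] :=
  boolP (has (fun m => (lin_deg m == b) && monomial_in D m) (msupp p)).
  (* One monomial of degree [b] on [D] forces all those of [p] onto [D], so this piece is kept
     whole. *)
  rewrite (_ : terms _ p = terms (fun m => lin_deg m == b) p) ?terms_lin_deg //.
  apply: terms_eq => m /=; case: eqP => //= mb.
  case: (boolP (m \in msupp p)) => [/pG mG|/mcoeff_outdom ->]; last by rewrite if_same.
  by rewrite (monomial_in_dual_cell _ m0D mG) // m0b mb.
rewrite (_ : terms _ p = 0) ?rpred0 //; apply/malgP => m; rewrite coeff_terms mcoeff0 /=.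
case: (boolP (m \in msupp p)) => [/none/negPf ->//|/mcoeff_outdom ->].
by rewrite if_same.
Qed.
End Lineality.

(** * Gluing *)

Section Gluing.
Variables (R : realType) (K : fieldType) (E : finType).
Variable I : ideal (polyring K E).
Hypotheses (homI : homogeneous_ideal I) (I1 : 1 \notin I).
Variable w : {ffun E -> R^o}.
Implicit Types (p q : polyring K E) (m : {cmonom E}).
Notation cells := (dual_cell I w).
Notation deg := (@lin_deg R K E I).

(** Only the monomial 1 has its degree, so the constant term of [p] is a graded piece and lies in
    [I]; a nonzero one would be a unit. *)
Lemma const_coeff0 p : p \in I -> p@_mone = 0.
Proof.
move=> pI; apply/eqP; apply: contraNT I1 => p1.
have := terms_lin_deg (deg mone) pI.
rewrite (_ : terms _ p = p@_mone *: 1).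
  by move/(ideal_scale (p@_mone)^-1); rewrite scalerA mulVf // scale1r.
apply/malgP => m; rewrite coeff_terms mcoeffZ mcoeff1.
have [->|m1] := eqVneq m mone; first by rewrite eqxx mulr1.
rewrite mulr0 ifF //; apply: contra_neqF m1 => /eqP/(lin_deg_mdeg homI).
by rewrite mdeg1 => /mdeg_eq0I.
Qed.

Let is_cell (D : {set E}) : bool := `[< exists C : cells, labels C = D >].

Lemma cell_eq (C C' : cells) : labels C = labels C' -> C = C'.
Proof.
by case: C C' => [D hD] [D' hD'] /= DD'; rewrite DD' in hD *; congr Cell; exact: Prop_irrelevance.
Qed.

(** An arbitrary cell, used as the default at the monomial 1. *)
Let C0 : cells := Cell (ex_intro _ 0 erefl).

(* The smallest cell supporting [m]; every cell supports the monomial 1, and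
   there need not be a smallest one. *)
Let mincell m : {set E} :=
  if m == mone then labels C0
  else \bigcap_(D : {set E} | is_cell D && monomial_in D m) D.

(** A variable [e] of [m] is a label of every cell supporting [m], so [min_labels_meet] makes each
    finite intersection of such cells a cell. *)
Lemma mincell_spec (C : cells) m : m != mone -> monomial_in C m ->
  exists2 C' : cells, labels C' = mincell m & dual_le C' C /\ monomial_in C' m.
Proof.
move=> m1 mC; rewrite /mincell (negPf m1); set M := \bigcap_(D | _) D.
have [e me] : exists e, m e != 0%N.
  apply/existsP; rewrite -negb_forall; apply: contraNN m1 => /forallP m0.
  by apply/eqP/cmonom_eq1 => e; exact/eqP.
have MC : M \subset C.
  by apply: (finset.bigcap_inf (labels C)); rewrite mC andbT; apply/asboolP; exists C.
(* The first alternative accounts for the empty intersection, which need not be a cell. *)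
have [MT|[C' C'M mC']] : M = [set: E] \/
    (exists2 C' : cells, labels C' = M & monomial_in C' m).
- apply: (big_ind (fun D : {set E} => D = [set: E] \/
    exists2 C' : cells, labels C' = D & monomial_in C' m)).
  + by left.
  + move=> D1 D2 [-> D2P|[C1 <- mC1]]; first by rewrite finset.setTI.
    case=> [->|[C2 <- mC2]]; first by right; exists C1; rewrite ?finset.setIT.
    right; have eC1 : e \in labels C1 by apply: (implyP (forallP mC1 e)).
    have eC2 : e \in labels C2 by apply: (implyP (forallP mC2 e)).
    have [f C1f] := labelsP C1; have [g C2g] := labelsP C2.
    rewrite C1f in eC1; rewrite C2g in eC2.
    have [h hE] := min_labels_meet eC1 eC2.
    exists (Cell (ex_intro _ h hE)); first by rewrite /= C1f C2g.
    apply/forallP => i; apply/implyP => mi; rewrite /= finset.in_setI -C1f -C2g.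
    by rewrite (implyP (forallP mC1 i)) ?(implyP (forallP mC2 i)).
  + by move=> D /andP[/asboolP[C' <-] mC']; right; exists C'.
(* Since [M] is contained in [C], the cell [C] has all labels and equals [M]. *)
- exists C => //; last by split => //; exact: subxx.
  by apply/eqP; rewrite MT finset.eqEsubset finset.subsetT -MT.
- by exists C' => //; split=> //; rewrite /dual_le /cell_le C'M.
Qed.

Lemma mincell_lin_deg (C C' : cells) m m' : deg m = deg m' ->
  monomial_in C m -> monomial_in C' m' -> mincell m = mincell m'.
Proof.
move=> mm' mC m'C'; have d := lin_deg_mdeg homI mm'.
rewrite /mincell -!mdeg_eq0 d; case: ifP => // _; apply: eq_bigl => D.
case: (boolP (is_cell D)) => //= /asboolP[C'' <-]; apply/idP/idP => mC''.
  exact: (monomial_in_dual_cell homI mm' mC'' m'C').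
exact: (monomial_in_dual_cell homI (esym mm') mC'' mC).
Qed.

(** Polynomial representatives of a compatible family, hence compatible only modulo [I]. *)
Variable q : cells -> polyring K E.
Hypothesis q_in : forall C, q C \in in_vars C.
Hypothesis q_compat : forall C G : cells, dual_le C G ->
  kill_outside K C (q G) - q C \in I.

Lemma const_coeff_compat C G : (q C)@_mone = (q G)@_mone.
Proof.
have loc (C' G' : cells) : dual_le C' G' -> (q C')@_mone = (q G')@_mone.
  move=> /q_compat /const_coeff0; rewrite mcoeffB coeff_kill_outside.
  by rewrite monomial_in1 => /eqP; rewrite subr_eq0 => /eqP.
have [f Cf] := labelsP C; have [g Gg] := labelsP G.
pose P h := (q (Cell (ex_intro _ h erefl)))@_mone.
have -> : (q C)@_mone = P f by apply: loc; rewrite /dual_le /cell_le Cf.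
have -> : (q G)@_mone = P g by apply: loc; rewrite /dual_le /cell_le Gg.
by apply: (min_labels_connected (u := - w) (a := lin_config I)) => h k hk; exact: loc.
Qed.

Lemma glue : exists p, forall C : cells, kill_outside K C p - q C \in I.
Proof.
(* Extends [q] by 0 to label sets that are not cells, so that the glued polynomial is a finite sum
   over subsets of [E]. *)
pose Q (D : {set E}) := if pselect (exists C : cells, labels C = D) is left h
  then q (sval (cid h)) else 0.
have QE (C : cells) : Q (labels C) = q C.
  rewrite /Q; case: pselect => [h|[]]; last by exists C.
  by congr q; apply: cell_eq; case: cid.
pose p := \sum_(D : {set E}) terms (fun m => mincell m == D) (Q D).
have pE m : p@_m = (Q (mincell m))@_m.
  rewrite raddf_sum (bigD1 (mincell m)) //= coeff_terms eqxx big1 ?addr0 // => D.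
  by rewrite coeff_terms eq_sym => /negPf->.
have killBE (C : cells) p' m : (kill_outside K C p' - q C)@_m =
    (if monomial_in C m then p'@_m else 0) - (q C)@_m.
  by rewrite mcoeffB coeff_kill_outside.
exists p => G; apply: (ideal_lin_deg (R := R)) => b.
(* If no monomial of degree [b] is supported on [G], the projection of [p] and [q G] both vanish in
   this degree. *)
have [[m0 m0b m0G]|none] := pselect (exists2 m, deg m = b & monomial_in G m); last first.
  rewrite (_ : terms _ _ = 0) ?rpred0 //; apply/malgP => m.
  rewrite coeff_terms mcoeff0 killBE.
  case: eqP => // mb; rewrite ifF; last by apply/negP => mG; apply: none; exists m.
  rewrite mcoeff_outdom ?subr0 //; apply/negP => /(in_varsP _ _ (q_in G)) mG.
  by apply: none; exists m.
(* In the degree of 1 only constant coefficients remain, and these agree on all cells. *)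
have [m01|m01] := eqVneq m0 mone.
  rewrite (_ : terms _ _ = 0) ?rpred0 //; apply/malgP => m.
  rewrite coeff_terms mcoeff0 killBE; case: eqP => // mb.
  have -> : m = mone.
    apply/mdeg_eq0I; rewrite (lin_deg_mdeg homI (_ : deg m = deg mone)) ?mdeg1 //.
    by rewrite mb -m0b m01.
  rewrite monomial_in1 pE /mincell eqxx QE.
  by apply/eqP; rewrite subr_eq0; apply/eqP/const_coeff_compat.
(* All monomials of degree [b] on [G] share the smallest cell [C]. There [p] agrees with [q C], so
   the error is minus the degree [b] piece of the compatibility relation for [C] and [G]. *)
have [C CE [CG m0C]] := mincell_spec m01 m0G.
rewrite (_ : terms _ _ = - terms (fun m => deg m == b) (kill_outside K C (q G) - q C)).
  by rewrite rpredN; apply: terms_lin_deg; exact: q_compat.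
apply/malgP => m; rewrite mcoeffN.
rewrite coeff_terms (coeff_terms _ (_ - _)); case: eqP => [mb|]; last by rewrite oppr0.
rewrite [LHS](killBE G p) (killBE C (q G)) opprB.
have mm0 : deg m0 = deg m by rewrite m0b mb.
have [mG|mG] := boolP (monomial_in G m).
  have -> : monomial_in C m by exact: (monomial_in_dual_cell homI mm0 m0C mG).
  by rewrite pE -(mincell_lin_deg mm0 m0C mG) -CE QE.
have mC : monomial_in C m = false.
  by apply: contraNF mG => mC; apply: (monomial_in_dual_cell homI mm0 m0G mC).
rewrite mC !mcoeff_outdom ?subr0 //.
  by apply: contraFN mC; exact: (in_varsP _ _ (q_in C)).
by apply: contraNN mG; exact: (in_varsP _ _ (q_in G)).
Qed.
End Gluing.

(** * The maps between the cell algebras *)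

Section Restriction.
Variables (K : comNzRingType) (E : finType) (D : {set E}).

(** The projection from the whole polynomial ring; [proj D p] is convertible to
    [restrict_vars D (val p)], so one ring morphism serves the diagram and the cone. *)
Definition restrict_vars (p : polyring K E) : subpolyring K D :=
  SubPoly (kill_outside_in D p).

Fact restrict_vars_zmod : zmod_morphism restrict_vars.
Proof. by move=> p q; apply: val_inj; exact: (rmorphB (kill_outside K D)). Qed.

Fact restrict_vars_monoid : monoid_morphism restrict_vars.
Proof.
split=> [|p q]; apply: val_inj; first exact: (rmorph1 (kill_outside K D)).
exact: (rmorphM (kill_outside K D)).
Qed.
HB.instance Definition _ := GRing.isZmodMorphism.Build
  (polyring K E) (subpolyring K D) restrict_vars restrict_vars_zmod.
HB.instance Definition _ := GRing.isMonoidMorphism.Build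
  (polyring K E) (subpolyring K D) restrict_vars restrict_vars_monoid.

Lemma restrict_varsA (a : K) : restrict_vars a%:A = a%:A.
Proof.
apply: val_inj; apply: etrans (kill_outside_id _) _ => //.
by apply: rpredZ; exact: rpred1.
Qed.

Lemma restrict_vars_val (p : subpolyring K D) : restrict_vars (val p) = p.
Proof. by apply: val_inj; apply: kill_outside_id; exact: valP. Qed.
End Restriction.

Section CellAlgebraMaps.
Variables (R : realType) (K : comNzRingType) (E : finType).
Variable I : ideal (polyring K E).
Hypothesis homI : homogeneous_ideal I.
Variable w : {ffun E -> R^o}.
Notation cells := (dual_cell I w).
Implicit Types D G : cells.

Lemma proj_restr_ideal D G (p : subpolyring K G) :
  p \in restr_ideal I G -> proj D p \in restr_ideal I D.
Proof. by rewrite !inE => pI; exact: (kill_outside_ideal homI D pI (valP p)). Qed.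

Lemma proj_restr_ideal_onto D G : dual_le D G ->
  forall q : subpolyring K D, q \in restr_ideal I D ->
  exists2 p : subpolyring K G, p \in restr_ideal I G & proj D p = q.
Proof.
(* The lift is [q] itself, read in the larger polynomial ring. *)
move=> DG q qI; exists (restrict_vars G (val q)); last first.
  apply: etrans (restrict_vars_val q); apply: val_inj.
  exact: kill_outside_comp.
have qG : val q \in in_vars G.
  apply/in_varsP => m /(in_varsP _ _ (valP q)) /forallP mD.
  apply/forallP => e; apply/implyP => me.
  by apply: (fintype.subsetP DG); apply: (implyP (mD e)).
by have : kill_outside K G (val q) \in I by rewrite kill_outside_id.
Qed.

Lemma diagram_map D G : exists h : calg_hom (cell_alg G) (cell_alg D),
  forall p : subpolyring K G, h (quot_pi _ p) = quot_pi _ (proj D p).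
Proof.
pose f : {rmorphism subpolyring K G -> cell_alg D} :=
  @quot_pi _ (restr_ideal I D) \o (restrict_vars D \o
    (val : {rmorphism subpolyring K G -> polyring K E})).
apply: (@quot_lift _ _ _ (cell_alg D) f) => [p pI|k].
  rewrite -(rmorph0 (quot_pi (restr_ideal I D))); apply/quot_piE.
  by rewrite subr0; exact: proj_restr_ideal pI.
by congr quot_pi; exact: restrict_varsA.
Qed.

(** Makes explicit the identification of the two quotients that the English statement writes as an
    equality. *)
Lemma ext_alg_map D : exists h : calg_hom (cell_alg D) (ext_alg D),
  forall p : subpolyring K D, h (quot_pi _ p) = quot_pi _ (val p).
Proof.
pose f : {rmorphism subpolyring K D -> ext_alg D} :=
  @quot_pi _ (ext_ideal I D) \o
    (val : {rmorphism subpolyring K D -> polyring K E}).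
apply: (@quot_lift _ _ _ (ext_alg D) f) => [p pI|k] //.
rewrite -(rmorph0 (quot_pi (ext_ideal I D))); apply/quot_piE.
rewrite subr0; apply/mem_ext_ideal; rewrite kill_outside_id //; exact: valP.
Qed.

Lemma cone_map D : exists h : calg_hom (inter_alg I w) (cell_alg D),
  forall p : polyring K E, h (quot_pi _ p) = quot_pi _ (restrict_vars D p).
Proof.
pose f : {rmorphism polyring K E -> cell_alg D} :=
  @quot_pi _ (restr_ideal I D) \o restrict_vars D.
apply: (@quot_lift _ _ _ (cell_alg D) f) => [p /asboolP pI|k].
  rewrite -(rmorph0 (quot_pi (restr_ideal I D))); apply/quot_piE.
  by rewrite subr0; apply/mem_ext_ideal; exact: pI.
by congr quot_pi; exact: restrict_varsA.
Qed.

(** Surjective because a polynomial is congruent to its projection modulo [ext_ideal I D]; injective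
    because the projection fixes polynomials in the variables of [D]. *)
Lemma ext_alg_map_bij D (h : calg_hom (cell_alg D) (ext_alg D)) :
    (forall p : subpolyring K D, h (quot_pi _ p) = quot_pi _ (val p)) ->
  bijective h.
Proof.
move=> hE.
have surj y : exists x, h x = y.
  case: (quot_pi_surj y) => p <-; exists (quot_pi _ (restrict_vars D p)).
  rewrite hE; apply/quot_piE/mem_ext_ideal.
  rewrite rmorphB (kill_outside_id (kill_outside_in _ _)) subrr; exact: rpred0.
have inj : injective h.
  move=> x y; case: (quot_pi_surj x) => p <-; case: (quot_pi_surj y) => q <-.
  rewrite !hE => /quot_piE /mem_ext_ideal pq; apply/quot_piE.
  by move: pq; rewrite kill_outside_id //; exact: (valP (p - q)).
exists (fun y => sval (cid (surj y))) => [x|y]; case: cid => //= z.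
exact: inj.
Qed.
End CellAlgebraMaps.

(** * Assembly of the diagram and its limit cone *)

Theorem theorem4p6 (R : realType) (E : finType) (I : ideal (polyring R[i] E))
    (homI : homogeneous_ideal I)
    (irrI : ~ {subset irrelevant_ideal R[i] E <= I})
    (w : {ffun E -> R^o}) :
  (forall D G : dual_cell I w, dual_le D G ->
     (forall p : subpolyring R[i] G,
        p \in restr_ideal I G -> proj D p \in restr_ideal I D) /\
     (forall q : subpolyring R[i] D, q \in restr_ideal I D ->
        exists2 p : subpolyring R[i] G, p \in restr_ideal I G & proj D p = q)) /\
  exists (Rdiag : diagram (@dual_le R R[i] E I w) (@cell_alg R R[i] E I w))
         (theta : forall D : dual_cell I w, calg_hom (cell_alg D) (ext_alg D))
         (c : forall D : dual_cell I w, calg_hom (inter_alg I w) (cell_alg D)),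
    [/\ forall (D G : dual_cell I w) (DG : dual_le D G),
          surjective (diag_map Rdiag DG) /\
          (forall p : subpolyring R[i] G,
             diag_map Rdiag DG (quot_pi _ p) = quot_pi _ (proj D p)),
        forall D : dual_cell I w,
          bijective (theta D) /\
          (forall p : subpolyring R[i] D,
             theta D (quot_pi _ p) = quot_pi _ (val p)),
        forall D : dual_cell I w,
          surjective (c D) /\
          (forall p : polyring R[i] E,
             theta D (c D (quot_pi _ p)) = quot_pi _ p),
        is_limit Rdiag c &
        exists2 phi : calg_hom (inter_alg I w) (lim_alg Rdiag),
          bijective phi &
          forall (D : dual_cell I w) (x : inter_alg I w),
            lim_val (phi x) D = c D x].
Proof.
have I1 : 1 \notin I.
  apply/negP => I1; apply: irrI => p _.
  by rewrite -[p]mulr1; exact: idealM.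
split=> [D G DG|].
  by split; [exact: proj_restr_ideal | exact: proj_restr_ideal_onto].
pose r D G (_ : dual_le D G) := sval (cid (@diagram_map R R[i] E I homI w D G)).
have rE D G (DG : dual_le D G) p : r D G DG (quot_pi _ p) = quot_pi _ (proj D p).
  by rewrite /r; case: cid.
have r_id D (DD : dual_le D D) x : r D D DD x = x.
  by case: (quot_pi_surj x) => p <-; rewrite rE [proj D p](restrict_vars_val p).
have r_comp D G H (DG : dual_le D G) (GH : dual_le G H) (DH : dual_le D H) x :
    r D H DH x = r D G DG (r G H GH x).
  case: (quot_pi_surj x) => p <-; rewrite !rE; congr quot_pi.
  by apply: val_inj; apply: esym; exact: kill_outside_comp.
pose theta D := sval (cid (@ext_alg_map R R[i] E I w D)).
have thetaE D p : theta D (quot_pi _ p) = quot_pi _ (val p).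
  by rewrite /theta; case: cid.
pose c D := sval (cid (@cone_map R R[i] E I w D)).
have cE D p : c D (quot_pi _ p) = quot_pi _ (restrict_vars D p).
  by rewrite /c; case: cid.
pose Rdiag := Diagram r_id r_comp.
have c_cone : is_cone Rdiag c.
  move=> D G DG x; case: (quot_pi_surj x) => p <-; rewrite !cE.
  apply: etrans (rE _ _ _ _) _; congr quot_pi.
  by apply: val_inj; exact: kill_outside_comp.
(* By [mem_ext_ideal], equality in every cell algebra puts the difference of representatives into
   every extended ideal, hence into their intersection. *)
have c_inj x y : (forall D, c D x = c D y) -> x = y.
  case: (quot_pi_surj x) => p <-; case: (quot_pi_surj y) => q <- pq.
  apply/quot_piE/asboolP => D; apply/mem_ext_ideal; have := pq D.
  by rewrite !cE => /quot_piE; rewrite -rmorphB.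
have c_lift (f : forall D, cell_alg D) :
    (forall D G (DG : dual_le D G), diag_map Rdiag DG (f G) = f D) ->
    exists x, forall D, c D x = f D.
  move=> f_compat; pose g D := sval (cid (quot_pi_surj (f D))).
  (* The chosen representatives satisfy the hypotheses of [glue], whose polynomial gives the
     lift. *)
  have gE D : quot_pi _ (g D) = f D by rewrite /g; case: cid.
  have [|D G DG|p pE] := @glue R R[i] E I homI I1 w (fun D => val (g D)).
  - by move=> D; exact: valP.
  - have : quot_pi (restr_ideal I D) (proj D (g G)) = quot_pi _ (g D).
      by rewrite -(rE D G DG) !gE; exact: f_compat.
    by move/quot_piE.
  - exists (quot_pi _ p) => D; rewrite cE -gE; apply/quot_piE; exact: pE.
exists Rdiag, theta, c; split.
- move=> D G DG; split=> [y|p]; last exact: rE.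
  case: (quot_pi_surj y) => q <-; exists (quot_pi _ (restrict_vars G (val q))).
  apply: etrans (rE _ _ _ _) _; congr quot_pi.
  by apply: etrans (restrict_vars_val q); apply: val_inj; exact: kill_outside_comp.
- by move=> D; split=> //; exact: ext_alg_map_bij.
- move=> D; split=> [y|p].
    case: (quot_pi_surj y) => q <-; exists (quot_pi _ (val q)).
    by rewrite cE restrict_vars_val.
  rewrite cE thetaE; apply/quot_piE/mem_ext_ideal.
  by rewrite rmorphB (kill_outside_id (kill_outside_in _ _)) subrr rpred0.
- exact: limit_of_lifts.
- have [phi phi_bij phiE] := lim_alg_iso c_cone c_inj c_lift.
  by exists phi.
Qed.
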